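(* Let $X$ be a complex separable Hilbert space, $A\in\mathcal B(X)$ self-adjoint, and $\mathcal G\subset X$ countable. Then $\{e^{tA}g\}_{g\in\mathcal G,\,t\in[0,1)}$ is a semi-continuous frame for $X$ if and only if $\{e^{tA}g\}_{g\in\mathcal G,\,t\in[0,\tau)}$ is a semi-continuous frame for $X$ for every $\tau\in(0,\infty)$.
   Context: $e^{tA}=\sum_{n\ge0}(tA)^n/n!$. The family $\{e^{tA}g\}_{g\in\mathcal G,t\in[0,\tau)}$ is a semi-continuous frame if there are $c_1,c_2>0$ with $c_1\|x\|^2\le\sum_{g\in\mathcal G}\int_0^\tau|\langle x,e^{tA}g\rangle|^2dt\le c_2\|x\|^2$ for all $x\in X$. *)

(* Defs.v *)
From Stdlib Require Import Reals List ClassicalEpsilon Factorial.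
Open Scope R_scope.

Record C := mkC { Re : R; Im : R }.
Definition C0 : C := mkC 0 0.
Definition C1 : C := mkC 1 0.
Definition RtoC (r : R) : C := mkC r 0.
Definition Cadd (a b : C) : C := mkC (Re a + Re b) (Im a + Im b).
Definition Cmul (a b : C) : C :=
  mkC (Re a * Re b - Im a * Im b) (Re a * Im b + Im a * Re b).
Definition Cconj (a : C) : C := mkC (Re a) (- Im a).
Definition Cabs2 (a : C) : R := Re a * Re a + Im a * Im a.

Record InnerProdSpace := {
  hv :> Type;
  hadd : hv -> hv -> hv;
  hzero : hv;
  hopp : hv -> hv;
  hscal : C -> hv -> hv;
  hinner : hv -> hv -> C;
  hadd_assoc : forall x y z, hadd x (hadd y z) = hadd (hadd x y) z;
  hadd_comm : forall x y, hadd x y = hadd y x;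
  hadd_0 : forall x, hadd x hzero = x;
  hadd_opp : forall x, hadd x (hopp x) = hzero;
  hscal_1 : forall x, hscal C1 x = x;
  hscal_assoc : forall a b x, hscal a (hscal b x) = hscal (Cmul a b) x;
  hscal_distr_v : forall a x y, hscal a (hadd x y) = hadd (hscal a x) (hscal a y);
  hscal_distr_s : forall a b x, hscal (Cadd a b) x = hadd (hscal a x) (hscal b x);
  hinner_add_l : forall x y z, hinner (hadd x y) z = Cadd (hinner x z) (hinner y z);
  hinner_scal_l : forall a x y, hinner (hscal a x) y = Cmul a (hinner x y);
  hinner_conj : forall x y, hinner y x = Cconj (hinner x y);
  hinner_pos : forall x, 0 <= Re (hinner x x);
  hinner_def : forall x, hinner x x = C0 -> x = hzero
}.

Section Ops.
Variable H : InnerProdSpace.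

Definition hnorm (x : H) : R := sqrt (Re (hinner H x x)).
Definition hsub (x y : H) : H := hadd H x (hopp H y).

Definition hconv (u : nat -> H) (l : H) : Prop :=
  Un_cv (fun n => hnorm (hsub (u n) l)) 0.

Definition hcomplete : Prop :=
  forall u : nat -> H,
    (forall eps, eps > 0 -> exists N, forall n m, (n >= N)%nat -> (m >= N)%nat ->
        hnorm (hsub (u n) (u m)) < eps) ->
    exists l, hconv u l.

Definition hseparable : Prop :=
  exists d : nat -> H, forall x eps, eps > 0 -> exists n, hnorm (hsub x (d n)) < eps.

(* the norm limit of a sequence (if it exists; default 0 otherwise) *)
Definition hlim (u : nat -> H) : H :=
  match excluded_middle_informative (exists l, hconv u l) with
  | left h => proj1_sig (constructive_indefinite_description _ h)
  | right _ => hzero H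
  end.

Definition bounded_linear (A : H -> H) : Prop :=
  (forall x y, A (hadd H x y) = hadd H (A x) (A y)) /\
  (forall a x, A (hscal H a x) = hscal H a (A x)) /\
  (exists M, forall x, hnorm (A x) <= M * hnorm x).

Definition self_adjoint (A : H -> H) : Prop :=
  forall x y, hinner H (A x) y = hinner H x (A y).

Fixpoint hsum (f : nat -> H) (N : nat) : H :=
  match N with
  | O => f O
  | S k => hadd H (hsum f k) (f (S k))
  end.

Definition expop (A : H -> H) (t : R) (g : H) : H :=
  hlim (hsum (fun n => hscal H (RtoC (t ^ n / INR (fact n))) (Nat.iter n A g))).

Definition countable (G : H -> Prop) : Prop :=
  exists f : nat -> H, forall g, G g -> exists n, f n = g.

End Ops.

(* Riemann integral of f over [a,b] (default 0 if not Riemann integrable) *)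
Definition is_RInt (f : R -> R) (a b v : R) : Prop :=
  exists pr : Riemann_integrable f a b, RiemannInt pr = v.
Definition Rint (f : R -> R) (a b : R) : R :=
  match excluded_middle_informative (exists v, is_RInt f a b v) with
  | left h => proj1_sig (constructive_indefinite_description _ h)
  | right _ => 0
  end.

(* finite partial sums of  sum_{g in G} int_0^tau |<x, e^{tA} g>|^2 dt
   over finite subsets of G (lists without duplicates) *)
Definition frame_partial_sums (H : InnerProdSpace) (A : H -> H) (G : H -> Prop)
    (tau : R) (x : H) (r : R) : Prop :=
  exists l : list H, NoDup l /\ (forall g, In g l -> G g) /\
    r = fold_right Rplus 0
          (map (fun g => Rint (fun t => Cabs2 (hinner H x (expop H A t g))) 0 tau) l).

(* {e^{tA} g}_{g in G, t in [0,tau)} is a semi-continuous frame: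
   the (unordered, nonnegative) sum over G equals a finite S = sup of the finite
   partial sums, and c1 ||x||^2 <= S <= c2 ||x||^2. *)
Definition semi_cont_frame (H : InnerProdSpace) (A : H -> H) (G : H -> Prop)
    (tau : R) : Prop :=
  exists c1 c2 : R, 0 < c1 /\ 0 < c2 /\
    forall x : H, exists S : R,
      is_lub (frame_partial_sums H A G tau x) S /\
      c1 * (hnorm H x) ^ 2 <= S /\ S <= c2 * (hnorm H x) ^ 2.

(* Main.v *)
(** Write [E t = e^(tA)], and for a finite [l] in [G] let [energy l y] be the sum of
    [|<y, g>|^2] over [g] in [l]; by self-adjointness the frame sum over [l] is the integral
    of [energy l (E t x)] over [[0, tau]].  The upper bound on [[0, 1]] forces [G] to be a Bessel
    family, [energy l y <= B |y|^2], which gives the upper bound for every [tau].  For the lower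
    bound one shows that, for every [eps],
    [energy l (E s x) <= K * (integral over [0, tau]) + eps |x|^2] for all [s] in [[0, 1]],
    with [K] independent of [l]: averaging gives it for [s < tau], comparing with Taylor
    polynomials as [s] tends to 0 gives it with [A^k] in place of [E s] for every [k], and
    summing the exponential series gives it for all [s].  Integrating over [[0, 1]] and taking
    [eps = c1 / 2] transfers the lower bound from [[0, 1]] to [[0, tau]]. *)

From Coquelicot Require Import Rcomplements Hierarchy Continuity RInt.
From Stdlib Require Import Reals Lra Lia List ClassicalEpsilon Factorial FunctionalExtensionality.
Require Import Defs.
Open Scope R_scope.

Local Notation "x [+] y" := (hadd _ x y) (at level 50, left associativity).
Local Notation "x [-] y" := (hsub _ x y) (at level 50, left associativity).
Local Notation "a [*] x" := (hscal _ (RtoC a) x) (at level 40).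
Local Notation "<[ x , y ]>" := (hinner _ x y) (at level 0).
Local Notation "‖ x ‖" := (hnorm _ x) (at level 0, x at level 9).

(** * Inner product spaces: Cauchy-Schwarz and the norm *)

Lemma C_ext (a b : Defs.C) : Re a = Re b -> Im a = Im b -> a = b.
Proof. destruct a, b; simpl; intros -> ->; reflexivity. Qed.

Section InnerProduct.
Variable H : InnerProdSpace.
Implicit Types x y z w : H.

Lemma hinner_zero_l w : <[hzero H, w]> = C0.
Proof.
  pose proof (hinner_add_l H (hzero H) (hzero H) w) as E.
  rewrite hadd_0 in E.
  apply C_ext; [apply (f_equal Re) in E | apply (f_equal Im) in E];
    simpl in *; lra.
Qed.

Lemma hinner_sub_l x y w : <[x [-] y, w]> = mkC (Re <[x, w]> - Re <[y, w]>) (Im <[x, w]> - Im <[y, w]>).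
Proof.
  pose proof (hinner_add_l H y (hopp H y) w) as E.
  rewrite hadd_opp, hinner_zero_l in E.
  unfold hsub; rewrite hinner_add_l.
  apply C_ext; [apply (f_equal Re) in E | apply (f_equal Im) in E];
    simpl in *; lra.
Qed.

(** Testing against every vector turns an identity between vectors into identities between real
    numbers; the tactic [vec] below rests on this. *)
Lemma hinner_ext x y : (forall w, <[x, w]> = <[y, w]>) -> x = y.
Proof.
  intros E.
  assert (E0 : x [-] y = hzero H).
  { apply hinner_def. rewrite hinner_sub_l, E. apply C_ext; simpl; lra. }
  rewrite <- (hadd_0 H x), <- (hadd_opp H y), (hadd_comm H y), hadd_assoc.
  change (x [-] y [+] y = y). rewrite E0, hadd_comm. apply hadd_0.
Qed.

Lemma Re_hinner_comm x y : Re <[x, y]> = Re <[y, x]>.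
Proof. rewrite (hinner_conj H y x); reflexivity. Qed.

Lemma Im_hinner_comm x y : Im <[x, y]> = - Im <[y, x]>.
Proof. rewrite (hinner_conj H y x); reflexivity. Qed.

Lemma Im_hinner_self x : Im <[x, x]> = 0.
Proof. pose proof (Im_hinner_comm x x); lra. Qed.

Lemma hnorm_ge0 x : 0 <= ‖x‖.
Proof. apply sqrt_pos. Qed.

Lemma hnorm_sqr x : ‖x‖ ^ 2 = Re <[x, x]>.
Proof. unfold hnorm. rewrite pow2_sqrt; [reflexivity | apply hinner_pos]. Qed.

(** The squared norm of [|y|^2 x - <x, y> y] is nonnegative and equals
    [|y|^2 (|x|^2 |y|^2 - |<x, y>|^2)]; one divides by [|y|^2], the case [y = 0] being separate. *)
Lemma Cauchy_Schwarz x y : Cabs2 <[x, y]> <= ‖x‖ ^ 2 * ‖y‖ ^ 2.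
Proof.
  rewrite !hnorm_sqr. unfold Cabs2.
  pose proof (hinner_pos H (hscal H (RtoC (Re <[y, y]>)) x [-] hscal H <[x, y]> y)) as P.
  rewrite hinner_sub_l, !hinner_scal_l in P. simpl in P.
  rewrite !(Re_hinner_comm _ (_ [-] _)), !(Im_hinner_comm _ (_ [-] _)) in P.
  rewrite !hinner_sub_l, !hinner_scal_l in P; simpl in P.
  rewrite !Im_hinner_self, (Re_hinner_comm y x), (Im_hinner_comm y x) in P.
  destruct (Req_dec (Re <[y, y]>) 0) as [Z | NZ].
  - assert (Y : y = hzero H).
    { apply hinner_def, C_ext; [exact Z | apply Im_hinner_self]. }
    rewrite (Re_hinner_comm x), (Im_hinner_comm x), Y, !hinner_zero_l; simpl; lra.
  - pose proof (hinner_pos H y) as Q.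
    apply (Rmult_le_reg_l (Re <[y, y]>)); [lra | nra].
Qed.

Lemma Re_hinner_le x y : Rabs (Re <[x, y]>) <= ‖x‖ * ‖y‖.
Proof.
  rewrite <- (Rabs_pos_eq (‖x‖ * ‖y‖)); [| apply Rmult_le_pos; apply hnorm_ge0].
  apply Rsqr_le_abs_0. pose proof (Cauchy_Schwarz x y) as P.
  unfold Cabs2 in P. unfold Rsqr. nra.
Qed.

Lemma Im_hinner_le x y : Rabs (Im <[x, y]>) <= ‖x‖ * ‖y‖.
Proof.
  rewrite <- (Rabs_pos_eq (‖x‖ * ‖y‖)); [| apply Rmult_le_pos; apply hnorm_ge0].
  apply Rsqr_le_abs_0. pose proof (Cauchy_Schwarz x y) as P.
  unfold Cabs2 in P. unfold Rsqr. nra.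
Qed.

Lemma hnorm_add x y : ‖(x [+] y)‖ <= ‖x‖ + ‖y‖.
Proof.
  apply Rsqr_incr_0_var; [| pose proof (hnorm_ge0 x); pose proof (hnorm_ge0 y); lra].
  rewrite !Rsqr_pow2, hnorm_sqr, hinner_add_l; simpl.
  rewrite !(Re_hinner_comm _ (_ [+] _)), !hinner_add_l; simpl.
  rewrite (Re_hinner_comm y x).
  pose proof (Re_hinner_le x y) as P. apply Rabs_le_between in P.
  pose proof (hnorm_sqr x). pose proof (hnorm_sqr y). nra.
Qed.

Lemma hnorm_scal a x : ‖(a [*] x)‖ = Rabs a * ‖x‖.
Proof.
  unfold hnorm. rewrite <- sqrt_Rsqr_abs, <- sqrt_mult; [| apply Rle_0_sqr | apply hinner_pos].
  f_equal. rewrite hinner_scal_l; simpl.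
  rewrite (Re_hinner_comm x), (Im_hinner_comm x), hinner_scal_l; simpl.
  rewrite Im_hinner_self. unfold Rsqr. ring.
Qed.

End InnerProduct.

Ltac vec := apply hinner_ext; intros; unfold RtoC;
  repeat first [rewrite hinner_sub_l | rewrite hinner_add_l
               | rewrite hinner_scal_l | rewrite hinner_zero_l];
  apply C_ext; simpl; try ring; try field.

Section InnerProduct2.
Variable H : InnerProdSpace.
Implicit Types x y z w : H.

Lemma hnorm_sub_sym x y : ‖(x [-] y)‖ = ‖(y [-] x)‖.
Proof.
  replace (x [-] y) with ((-1) [*] (y [-] x)) by vec.
  rewrite hnorm_scal, Rabs_left; lra.
Qed.

Lemma hnorm_sub_trans y x z : ‖(x [-] z)‖ <= ‖(x [-] y)‖ + ‖(y [-] z)‖.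
Proof.
  replace (x [-] z) with ((x [-] y) [+] (y [-] z)) by vec.
  apply hnorm_add.
Qed.

Lemma hnorm_sub_le x y : ‖x‖ <= ‖(x [-] y)‖ + ‖y‖.
Proof. replace x with ((x [-] y) [+] y) at 1 by vec. apply hnorm_add. Qed.

Lemma hnorm_sub_self x : ‖(x [-] x)‖ = 0.
Proof. replace (x [-] x) with (0 [*] x) by vec. rewrite hnorm_scal, Rabs_R0; ring. Qed.

Lemma hnorm_sub_eq0 x y : ‖(x [-] y)‖ = 0 -> x = y.
Proof.
  intros E. assert (Z : x [-] y = hzero H).
  { apply hinner_def, C_ext; [| apply Im_hinner_self].
    rewrite <- hnorm_sqr, E. simpl; ring. }
  replace x with ((x [-] y) [+] y) by vec. rewrite Z. vec.
Qed.

End InnerProduct2.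

(** * Norm limits and series with a summable majorant *)

Section Series.
Variable H : InnerProdSpace.

Lemma hconv_le (u : nat -> H) l v c N :
  hconv H u l -> (forall n, (N <= n)%nat -> ‖(u n [-] v)‖ <= c) -> ‖(l [-] v)‖ <= c.
Proof.
  intros U C. apply le_epsilon. intros eps He.
  destruct (U eps He) as [m Hm].
  specialize (Hm (max m N) ltac:(lia)). specialize (C (max m N) ltac:(lia)).
  unfold Rdist in Hm. rewrite Rminus_0_r, Rabs_pos_eq in Hm by apply hnorm_ge0.
  pose proof (hnorm_sub_trans H (u (max m N)) l v) as T.
  rewrite (hnorm_sub_sym H l (u (max m N))) in T. lra.
Qed.

Lemma hlim_hconv (u : nat -> H) : (exists l, hconv H u l) -> hconv H u (hlim H u).
Proof.
  intros E. unfold hlim. destruct excluded_middle_informative; [| contradiction].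
  apply proj2_sig.
Qed.

Lemma Un_cv_squeeze0 (u v : nat -> R) l :
  (forall n, Rabs (u n - l) <= v n) -> Un_cv v 0 -> Un_cv u l.
Proof.
  intros B V eps He. destruct (V eps He) as [N HN]. exists N. intros n Hn.
  specialize (HN n Hn). unfold Rdist in *. specialize (B n).
  rewrite Rminus_0_r in HN. apply Rabs_def2 in HN. lra.
Qed.

Lemma Un_cv_mult_0 (u : nat -> R) c : Un_cv u 0 -> Un_cv (fun n => u n * c) 0.
Proof.
  intros U. rewrite <- (Rmult_0_l c). apply CV_mult; [exact U |].
  intros eps He; exists 0%nat; intros; rewrite Rdist_eq; exact He.
Qed.

Lemma hconv_Re_hinner (u : nat -> H) l g :
  hconv H u l -> Un_cv (fun n => Re <[u n, g]>) (Re <[l, g]>).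
Proof.
  intros U. apply (Un_cv_squeeze0 _ (fun n => ‖(u n [-] l)‖ * ‖g‖)).
  - intros n. pose proof (Re_hinner_le H (u n [-] l) g) as P.
    rewrite hinner_sub_l in P. exact P.
  - apply Un_cv_mult_0, U.
Qed.

Lemma hconv_Im_hinner (u : nat -> H) l g :
  hconv H u l -> Un_cv (fun n => Im <[u n, g]>) (Im <[l, g]>).
Proof.
  intros U. apply (Un_cv_squeeze0 _ (fun n => ‖(u n [-] l)‖ * ‖g‖)).
  - intros n. pose proof (Im_hinner_le H (u n [-] l) g) as P.
    rewrite hinner_sub_l in P. exact P.
  - apply Un_cv_mult_0, U.
Qed.

Section Majorized.
Variables (f : nat -> H) (a : nat -> R) (s : R).
Hypothesis fa : forall k, ‖(f k)‖ <= a k.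
Hypothesis as_ : Un_cv (sum_f_R0 a) s.

Lemma sum_majorant_le n : sum_f_R0 a n <= s.
Proof.
  apply growing_ineq; [| exact as_]. intros k; simpl.
  pose proof (fa (S k)). pose proof (hnorm_ge0 H (f (S k))). lra.
Qed.

Lemma hsum_tail n m : (n <= m)%nat ->
  ‖(hsum H f m [-] hsum H f n)‖ <= sum_f_R0 a m - sum_f_R0 a n.
Proof.
  induction 1 as [| m _ IH].
  - rewrite hnorm_sub_self; lra.
  - simpl. replace (hsum H f m [+] f (S m) [-] hsum H f n)
      with ((hsum H f m [-] hsum H f n) [+] f (S m)) by vec.
    pose proof (hnorm_add H (hsum H f m [-] hsum H f n) (f (S m))).
    pose proof (fa (S m)). lra.
Qed.

(** Weierstrass test: the tails of the majorant dominate the differences of partial sums, so these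
    form a Cauchy sequence. *)
Lemma hconv_hsum : hcomplete H -> hconv H (hsum H f) (hlim H (hsum H f)).
Proof.
  intros HC. apply hlim_hconv, HC. intros eps He.
  destruct (as_ (eps / 2) ltac:(lra)) as [N HN].
  assert (T : forall n, (n >= N)%nat -> ‖(hsum H f n [-] hsum H f N)‖ < eps / 2).
  { intros n Hn. eapply Rle_lt_trans; [apply hsum_tail, Hn |].
    specialize (HN N ltac:(lia)). unfold Rdist in HN. apply Rabs_def2 in HN.
    pose proof (sum_majorant_le n). lra. }
  exists N. intros n m Hn Hm.
  pose proof (hnorm_sub_trans H (hsum H f N) (hsum H f n) (hsum H f m)).
  rewrite (hnorm_sub_sym H (hsum H f N) (hsum H f m)) in *.
  pose proof (T n Hn). pose proof (T m Hm). lra.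
Qed.

Lemma hlim_hsum_tail n : hcomplete H ->
  ‖(hlim H (hsum H f) [-] hsum H f n)‖ <= s - sum_f_R0 a n.
Proof.
  intros HC. apply (hconv_le (hsum H f) _ _ _ n); [apply hconv_hsum, HC |].
  intros m Hm. pose proof (hsum_tail n m Hm). pose proof (sum_majorant_le m). lra.
Qed.

End Majorized.
End Series.

(** * Tails of the real exponential series *)

Definition exp_partial (u : R) (n : nat) : R := sum_f_R0 (fun k => u ^ k / INR (fact k)) n.

Lemma exp_partial_S u n :
  exp_partial u (S n) = exp_partial u n + u ^ S n / INR (fact (S n)).
Proof. reflexivity. Qed.

Lemma exp_partial_cv u : Un_cv (exp_partial u) (exp u).
Proof.
  unfold exp. destruct (exist_exp u) as [l E]; simpl. intros eps He.
  destruct (E eps He) as [N HN]. exists N. intros n Hn. specialize (HN n Hn).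
  unfold exp_partial. erewrite sum_eq; [exact HN |]. intros; simpl. unfold Rdiv; ring.
Qed.

Lemma pow_div_fact_ge0 u k : 0 <= u -> 0 <= u ^ k / INR (fact k).
Proof.
  intros Hu. apply Rdiv_le_0_compat; [apply pow_le, Hu | apply INR_fact_lt_0].
Qed.

Lemma exp_partial_le u n : 0 <= u -> exp_partial u n <= exp u.
Proof.
  intros Hu. apply growing_ineq; [| apply exp_partial_cv]. intros k.
  rewrite exp_partial_S. pose proof (pow_div_fact_ge0 u (S k) Hu). lra.
Qed.

(** The inequality [(n+1+j)! >= j!] lets [u^(n+1)] be factored out of the tail. What matters later
    is this order of vanishing as [u] tends to 0, not the constant. *)
Lemma exp_partial_tail_aux u n m : 0 <= u ->
  exp_partial u (S n + m) - exp_partial u n <= u ^ S n * exp_partial u m.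
Proof.
  intros Hu.
  assert (T : forall j, u ^ (S n + j) / INR (fact (S n + j)) <= u ^ S n * (u ^ j / INR (fact j))).
  { intros j. rewrite pow_add. unfold Rdiv. rewrite Rmult_assoc.
    apply Rmult_le_compat_l; [apply pow_le, Hu |].
    apply Rmult_le_compat_l; [apply pow_le, Hu |].
    apply Rinv_le_contravar; [apply INR_fact_lt_0 |].
    apply le_INR, fact_le; lia. }
  induction m as [| m IH].
  - pose proof (T 0%nat) as T0. rewrite Nat.add_0_r in T0.
    rewrite Nat.add_0_r, exp_partial_S. change (exp_partial u 0) with (u ^ 0 / INR (fact 0)). lra.
  - pose proof (T (S m)) as TS. rewrite Nat.add_succ_r in *.
    rewrite !exp_partial_S. lra.
Qed.

Lemma exp_partial_tail u n : 0 <= u -> exp u - exp_partial u n <= u ^ S n * exp u.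
Proof.
  intros Hu. apply le_epsilon. intros eps He.
  destruct (exp_partial_cv u eps He) as [N HN].
  specialize (HN (S n + N)%nat ltac:(lia)). unfold Rdist in HN. apply Rabs_def2 in HN.
  pose proof (exp_partial_tail_aux u n N Hu).
  pose proof (Rmult_le_compat_l (u ^ S n) _ _ (pow_le u (S n) Hu) (exp_partial_le u N Hu)).
  lra.
Qed.

(** A mean value bound for powers, by induction; it gives the Lipschitz bound for each term of the
    exponential series. *)
Lemma pow_sub_le r s t n : Rabs s <= r -> Rabs t <= r ->
  Rabs (t ^ S n - s ^ S n) <= INR (S n) * Rabs (t - s) * r ^ n.
Proof.
  intros Hs Ht. pose proof (Rabs_pos s) as Ps. pose proof (Rabs_pos (t - s)) as Pd.
  induction n as [| n IH].
  - simpl. rewrite !Rmult_1_r. lra.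
  - replace (t ^ S (S n) - s ^ S (S n)) with (t ^ S n * (t - s) + s * (t ^ S n - s ^ S n))
      by (simpl; ring).
    eapply Rle_trans; [apply Rabs_triang |]. rewrite !Rabs_mult, <- RPow_abs.
    replace (INR (S (S n)) * Rabs (t - s) * r ^ S n) with
      (r ^ S n * Rabs (t - s) + r * (INR (S n) * Rabs (t - s) * r ^ n))
      by (rewrite (S_INR (S n)); simpl pow; ring).
    apply Rplus_le_compat.
    + apply Rmult_le_compat_r; [exact Pd |]. apply pow_incr. split; [apply Rabs_pos | exact Ht].
    + apply Rmult_le_compat; auto using Rabs_pos.
Qed.

(** * The operator exponential: Taylor remainder, Lipschitz bound, adjoint *)

Definition expsum (H : InnerProdSpace) (A : H -> H) (n : nat) (t : R) (x : H) : H :=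
  hsum H (fun k => (t ^ k / INR (fact k)) [*] Nat.iter k A x) n.

Section Exponential.
Variables (H : InnerProdSpace) (A : H -> H) (M : R).
Hypothesis Hcomp : hcomplete H.
Hypothesis M_ge0 : 0 <= M.
Hypothesis A_le : forall x, ‖(A x)‖ <= M * ‖x‖.

Lemma expsum_0 t x : expsum H A 0 t x = x.
Proof. unfold expsum; simpl. vec. Qed.

Lemma expsum_S n t x : expsum H A (S n) t x =
  expsum H A n t x [+] (t ^ S n / INR (fact (S n))) [*] Nat.iter (S n) A x.
Proof. reflexivity. Qed.

Lemma hnorm_iter_le k x : ‖(Nat.iter k A x)‖ <= M ^ k * ‖x‖.
Proof.
  induction k as [| k IH]; simpl; [lra |].
  eapply Rle_trans; [apply A_le |]. rewrite Rmult_assoc.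
  apply Rmult_le_compat_l; assumption.
Qed.

Lemma exp_term_le r t k x : Rabs t <= r ->
  ‖((t ^ k / INR (fact k)) [*] Nat.iter k A x)‖ <= (r * M) ^ k / INR (fact k) * ‖x‖.
Proof.
  intros Ht. pose proof (INR_fact_lt_0 k) as F. pose proof (Rabs_pos t) as Pt.
  rewrite hnorm_scal, Rabs_div, <- RPow_abs, (Rabs_pos_eq (INR _)) by lra.
  rewrite Rpow_mult_distr.
  replace (r ^ k * M ^ k / INR (fact k) * ‖x‖)
    with (r ^ k / INR (fact k) * (M ^ k * ‖x‖)) by (field; lra).
  apply Rmult_le_compat; [apply pow_div_fact_ge0, Pt | apply hnorm_ge0 | | apply hnorm_iter_le].
  apply Rmult_le_compat_r; [left; apply Rinv_0_lt_compat, F |].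
  apply pow_incr; lra.
Qed.

Lemma exp_majorant_sum u (x : H) n :
  sum_f_R0 (fun k => u ^ k / INR (fact k) * ‖x‖) n = exp_partial u n * ‖x‖.
Proof. unfold exp_partial. rewrite Rmult_comm, scal_sum. reflexivity. Qed.

Lemma exp_majorant_cv u (x : H) :
  Un_cv (sum_f_R0 (fun k => u ^ k / INR (fact k) * ‖x‖)) (exp u * ‖x‖).
Proof.
  intros eps He.
  assert (CVc : Un_cv (fun _ => ‖x‖) ‖x‖)
    by (intros e ?; exists 0%nat; intros; rewrite Rdist_eq; assumption).
  destruct (CV_mult _ _ _ _ (exp_partial_cv u) CVc eps He) as [N HN].
  exists N. intros n Hn. rewrite exp_majorant_sum. apply HN, Hn.
Qed.

Lemma expop_cv t x : hconv H (fun n => expsum H A n t x) (expop H A t x).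
Proof.
  exact (hconv_hsum H _ _ _ (fun k => exp_term_le _ t k x (Rle_refl _))
           (exp_majorant_cv _ x) Hcomp).
Qed.

(** The scalar series of [exp (r * M)] majorizes the operator series for all [|t| <= r] at once, so
    the remainder bound is uniform in [t]. *)
Lemma expop_tail r t x n : Rabs t <= r ->
  ‖(expop H A t x [-] expsum H A n t x)‖ <= (exp (r * M) - exp_partial (r * M) n) * ‖x‖.
Proof.
  intros Ht.
  pose proof (hlim_hsum_tail H _ _ _ (fun k => exp_term_le r t k x Ht) (exp_majorant_cv _ x)
                n Hcomp) as T.
  rewrite exp_majorant_sum, <- Rmult_minus_distr_r in T. exact T.
Qed.

Lemma expop_0 x : expop H A 0 x = x.
Proof.
  apply hnorm_sub_eq0.
  (* For [r = 0] and degree 0 the remainder bound is [exp 0 - 1 = 0]. *)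
  pose proof (expop_tail 0 0 x 0 ltac:(rewrite Rabs_R0; lra)) as T.
  rewrite expsum_0, Rmult_0_l, exp_0 in T.
  change (exp_partial 0 0) with (1 / 1) in T.
  pose proof (hnorm_ge0 H (expop H A 0 x [-] x)). lra.
Qed.

Lemma hnorm_expop_le r t x : Rabs t <= r -> ‖(expop H A t x)‖ <= exp (r * M) * ‖x‖.
Proof.
  intros Ht. pose proof (expop_tail r t x 0 Ht) as T. rewrite expsum_0 in T.
  change (exp_partial (r * M) 0) with (1 / 1) in T.
  pose proof (hnorm_sub_le H (expop H A t x) x). lra.
Qed.

(** Constant terms cancel. In the term of degree [k+1] the factor [k+1] from [pow_sub_le] reduces
    [(k+1)!] to [k!], which leaves [M] times the exponential series at [r * M]; hence the shift from
    [S n] to [n]. *)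
Lemma expsum_lipschitz r s t x n : Rabs s <= r -> Rabs t <= r ->
  ‖(expsum H A (S n) t x [-] expsum H A (S n) s x)‖
    <= Rabs (t - s) * (M * exp_partial (r * M) n) * ‖x‖.
Proof.
  intros Hs Ht.
  assert (T : forall k, ‖((t ^ S k / INR (fact (S k)) - s ^ S k / INR (fact (S k)))
                [*] Nat.iter (S k) A x)‖
              <= Rabs (t - s) * (M * ((r * M) ^ k / INR (fact k))) * ‖x‖).
  { intros k. pose proof (INR_fact_lt_0 k) as F.
    assert (Fk : INR (fact (S k)) = INR (S k) * INR (fact k)) by apply mult_INR.
    assert (Sk : 0 < INR (S k)) by (apply lt_0_INR; lia).
    rewrite hnorm_scal, <- Rdiv_minus_distr, Rabs_div by (rewrite Fk; nra).
    rewrite (Rabs_pos_eq (INR _)) by (rewrite Fk; nra).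
    apply Rle_trans with (INR (S k) * Rabs (t - s) * r ^ k / INR (fact (S k)) * (M ^ S k * ‖x‖)).
    - apply Rmult_le_compat; [| apply hnorm_ge0 | | apply hnorm_iter_le].
      + apply Rdiv_le_0_compat; [apply Rabs_pos | rewrite Fk; nra].
      + apply Rmult_le_compat_r; [| apply pow_sub_le; assumption].
        left; apply Rinv_0_lt_compat; rewrite Fk; nra.
    - right. rewrite Fk, Rpow_mult_distr. simpl pow. field. lra. }
  induction n as [| n IH].
  - rewrite !expsum_S, !expsum_0.
    replace (x [+] _ [-] _) with ((t ^ 1 / INR (fact 1) - s ^ 1 / INR (fact 1)) [*] Nat.iter 1 A x)
      by (simpl Nat.iter; vec; apply INR_fact_neq_0).
    exact (T 0%nat).
  - rewrite (expsum_S (S n)), (expsum_S (S n)), exp_partial_S.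
    replace (_ [+] _ [-] _) with ((expsum H A (S n) t x [-] expsum H A (S n) s x) [+]
      (t ^ S (S n) / INR (fact (S (S n))) - s ^ S (S n) / INR (fact (S (S n))))
         [*] Nat.iter (S (S n)) A x) by (vec; apply INR_fact_neq_0).
    eapply Rle_trans; [apply hnorm_add |]. pose proof (T (S n)). lra.
Qed.

Lemma expop_lipschitz r s t x : Rabs s <= r -> Rabs t <= r ->
  ‖(expop H A t x [-] expop H A s x)‖ <= Rabs (t - s) * (M * exp (r * M)) * ‖x‖.
Proof.
  intros Hs Ht. apply le_epsilon. intros eps He.
  destruct (expop_cv t x (eps / 2) ltac:(lra)) as [N1 H1].
  destruct (expop_cv s x (eps / 2) ltac:(lra)) as [N2 H2].
  set (n := S (max N1 N2)).
  specialize (H1 n ltac:(lia)). specialize (H2 n ltac:(lia)).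
  unfold Rdist in H1, H2. rewrite Rminus_0_r, Rabs_pos_eq in H1, H2 by apply hnorm_ge0.
  assert (L : ‖(expsum H A n t x [-] expsum H A n s x)‖
              <= Rabs (t - s) * (M * exp (r * M)) * ‖x‖).
  { eapply Rle_trans; [apply expsum_lipschitz; eassumption |].
    apply Rmult_le_compat_r; [apply hnorm_ge0 |].
    apply Rmult_le_compat_l; [apply Rabs_pos |].
    apply Rmult_le_compat_l; [exact M_ge0 |]. apply exp_partial_le.
    apply Rmult_le_pos; [| exact M_ge0]. pose proof (Rabs_pos s); lra. }
  rewrite hnorm_sub_sym in H1.
  pose proof (hnorm_sub_trans H (expsum H A n t x) (expop H A t x) (expop H A s x)).
  pose proof (hnorm_sub_trans H (expsum H A n s x) (expsum H A n t x) (expop H A s x)).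
  lra.
Qed.

(** Moving the exponential from [g] to [x] makes all frame coefficients at time [t] inner products
    with the single vector [e^(tA) x]. The identity holds for the Taylor polynomials and passes to
    the limit in real and imaginary parts. *)
Lemma expop_self_adjoint t x g : self_adjoint H A ->
  <[x, expop H A t g]> = <[expop H A t x, g]>.
Proof.
  intros Asa.
  assert (It : forall k y z, <[Nat.iter k A y, z]> = <[y, Nat.iter k A z]>).
  { induction k as [| k IH]; intros y z; [reflexivity |].
    simpl. rewrite Asa, IH, Nat.iter_swap. reflexivity. }
  assert (Sm : forall n, <[expsum H A n t x, g]> = Cconj <[expsum H A n t g, x]>).
  { unfold expsum. induction n as [| n IH]; simpl.
    - rewrite !hinner_scal_l, (hinner_conj H x g). apply C_ext; simpl; ring.
    - rewrite !hinner_add_l, IH, !hinner_scal_l.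
      change (A (Nat.iter n A x)) with (Nat.iter (S n) A x).
      rewrite It, (hinner_conj H (Nat.iter (S n) A g) x).
      apply C_ext; simpl; ring. }
  rewrite hinner_conj. apply C_ext; simpl.
  - eapply UL_sequence; [apply hconv_Re_hinner, expop_cv |].
    pose proof (hconv_Re_hinner _ _ _ g (expop_cv t x)) as U.
    intros eps He. destruct (U eps He) as [N HN]. exists N. intros n Hn.
    specialize (HN n Hn). simpl in HN. rewrite Sm in HN. exact HN.
  - pose proof (hconv_Im_hinner _ _ _ g (expop_cv t x)) as U.
    pose proof (CV_opp _ _ (hconv_Im_hinner _ _ _ x (expop_cv t g))) as V.
    eapply UL_sequence; [exact V |].
    intros eps He. destruct (U eps He) as [N HN]. exists N. intros n Hn.
    specialize (HN n Hn). simpl in HN. rewrite Sm in HN. exact HN.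
Qed.
End Exponential.

(** * The energy of a vector against a finite family *)

Definition energy (H : InnerProdSpace) (l : list H) (y : H) : R :=
  fold_right Rplus 0 (map (fun g => Cabs2 <[y, g]>) l).

Section Energy.
Variable H : InnerProdSpace.
Implicit Types (l : list H) (x y z : H).

Lemma energy_ge0 l y : 0 <= energy H l y.
Proof.
  unfold energy, Cabs2. induction l as [| g l IH]; simpl; [lra | nra].
Qed.

Lemma energy_add l y z : energy H l (y [+] z) <= 2 * energy H l y + 2 * energy H l z.
Proof.
  unfold energy, Cabs2. induction l as [| g l IH]; simpl; [lra |].
  rewrite hinner_add_l; simpl. set (a := fold_right _ _ _) in *.
  set (b := fold_right _ _ _) in *. set (c := fold_right _ _ _) in *.
  pose proof (pow2_ge_0 (Re <[y, g]> - Re <[z, g]>)).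
  pose proof (pow2_ge_0 (Im <[y, g]> - Im <[z, g]>)). nra.
Qed.

Lemma energy_scal l a y : energy H l (a [*] y) = a ^ 2 * energy H l y.
Proof.
  unfold energy, Cabs2. induction l as [| g l IH]; simpl; [ring |].
  simpl in IH. rewrite IH, hinner_scal_l; simpl. ring.
Qed.

Lemma energy_sub l y z : energy H l (y [-] z) <= 2 * energy H l y + 2 * energy H l z.
Proof.
  replace (y [-] z) with (y [+] (-1) [*] z) by vec.
  eapply Rle_trans; [apply energy_add |]. rewrite energy_scal. lra.
Qed.

(** A crude Bessel constant that depends on [l]; it starts the iteration in [energy_bessel]. *)
Lemma energy_le l y :
  energy H l y <= fold_right Rplus 0 (map (fun g => ‖g‖ ^ 2) l) * ‖y‖ ^ 2.
Proof.
  unfold energy. induction l as [| g l IH]; cbn [map fold_right]; [lra |].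
  pose proof (Cauchy_Schwarz H y g). lra.
Qed.

Lemma energy_sub_le l B y z : (forall w, energy H l w <= B * ‖w‖ ^ 2) ->
  energy H l y <= 2 * energy H l z + 2 * (B * ‖(y [-] z)‖ ^ 2).
Proof.
  intros HB. replace y with (z [+] (y [-] z)) at 1 by vec.
  eapply Rle_trans; [apply energy_add |]. pose proof (HB (y [-] z)). lra.
Qed.

End Energy.

(** * Continuity and the two forms of the Riemann integral *)

Lemma locally_lipschitz_continuity (f : R -> R) :
  (forall r, exists K, forall s t, Rabs s <= r -> Rabs t <= r ->
     Rabs (f t - f s) <= K * Rabs (t - s)) -> continuity f.
Proof.
  intros L s eps He. destruct (L (Rabs s + 1)) as [K HK].
  (* The constant [K] may be zero or negative, so [|K| + 1] serves as the Lipschitz constant; the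
     radius [|s| + 1] covers all [t] within distance 1 of [s]. *)
  assert (P : 0 < Rabs K + 1) by (pose proof (Rabs_pos K); lra).
  exists (Rmin 1 (eps / (Rabs K + 1))). split.
  - apply Rmin_pos; [lra | apply Rdiv_lt_0_compat; lra].
  - intros t [_ Ht]. simpl in *. unfold Rdist in *.
    assert (H1 : Rabs (t - s) < 1) by (eapply Rlt_le_trans; [exact Ht | apply Rmin_l]).
    assert (H2 : Rabs (t - s) < eps / (Rabs K + 1))
      by (eapply Rlt_le_trans; [exact Ht | apply Rmin_r]).
    apply (Rmult_lt_compat_l (Rabs K + 1)) in H2; [| exact P].
    replace ((Rabs K + 1) * (eps / (Rabs K + 1))) with eps in H2 by (field; lra).
    eapply Rle_lt_trans; [apply HK | eapply Rle_lt_trans; [| exact H2]].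
    + lra.
    + replace t with (s + (t - s)) by ring. pose proof (Rabs_triang s (t - s)). lra.
    + apply Rmult_le_compat_r; [apply Rabs_pos |]. pose proof (Rle_abs K). lra.
Qed.

Lemma continuity_ex_RInt (f : R -> R) a b : continuity f -> ex_RInt f a b.
Proof.
  intros C. apply (ex_RInt_continuous (V := R_CompleteNormedModule)).
  intros z _. apply continuity_pt_filterlim, C.
Qed.

(** Integrability excludes the default value 0 of [Rint], so the calculus of [RInt] becomes
    available for the integrals in the definition of a frame. *)
Lemma Rint_eq_RInt (f : R -> R) a b : ex_RInt f a b -> Rint f a b = RInt f a b.
Proof.
  intros E. unfold Rint. destruct excluded_middle_informative as [e | n].
  - destruct (proj2_sig (constructive_indefinite_description _ e)) as [pr <-].
    symmetry; apply RInt_Reals.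
  - exfalso. apply n. exists (RiemannInt (ex_RInt_Reals_0 _ _ _ E)).
    exists (ex_RInt_Reals_0 _ _ _ E). reflexivity.
Qed.

(** * The energy integrated along an orbit *)

Section Orbit.
Variables (H : InnerProdSpace) (A : H -> H) (M : R).
Hypothesis Hcomp : hcomplete H.
Hypothesis M_ge0 : 0 <= M.
Hypothesis A_le : forall x, ‖(A x)‖ <= M * ‖x‖.

Lemma continuity_Re_expop x g : continuity (fun t => Re <[expop H A t x, g]>).
Proof.
  apply locally_lipschitz_continuity. intros r.
  exists (M * exp (r * M) * ‖x‖ * ‖g‖). intros s t Hs Ht.
  pose proof (Re_hinner_le H (expop H A t x [-] expop H A s x) g) as P.
  rewrite hinner_sub_l in P. simpl in P.
  pose proof (Rmult_le_compat_r ‖g‖ _ _ (hnorm_ge0 _ _)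
    (expop_lipschitz H A M Hcomp M_ge0 A_le r s t x Hs Ht)). lra.
Qed.

Lemma continuity_Im_expop x g : continuity (fun t => Im <[expop H A t x, g]>).
Proof.
  apply locally_lipschitz_continuity. intros r.
  exists (M * exp (r * M) * ‖x‖ * ‖g‖). intros s t Hs Ht.
  pose proof (Im_hinner_le H (expop H A t x [-] expop H A s x) g) as P.
  rewrite hinner_sub_l in P. simpl in P.
  pose proof (Rmult_le_compat_r ‖g‖ _ _ (hnorm_ge0 _ _)
    (expop_lipschitz H A M Hcomp M_ge0 A_le r s t x Hs Ht)). lra.
Qed.

Lemma continuity_Cabs2_expop x g : continuity (fun t => Cabs2 <[expop H A t x, g]>).
Proof.
  apply (continuity_plus (fun t => Re _ * Re _) (fun t => Im _ * Im _));
    apply (continuity_mult (fun t => _) (fun t => _));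
    auto using continuity_Re_expop, continuity_Im_expop.
Qed.

Lemma continuity_energy_expop l x : continuity (fun t => energy H l (expop H A t x)).
Proof.
  unfold energy. induction l as [| g l IH]; simpl.
  - apply continuity_const. intros s t; reflexivity.
  - apply (continuity_plus (fun t => Cabs2 _) (fun t => fold_right _ _ _));
      [apply continuity_Cabs2_expop | exact IH].
Qed.

Definition orbit_energy (l : list H) (tau : R) (x : H) : R :=
  RInt (fun t => energy H l (expop H A t x)) 0 tau.

Lemma ex_RInt_energy l x a b : ex_RInt (fun t => energy H l (expop H A t x)) a b.
Proof. apply continuity_ex_RInt, continuity_energy_expop. Qed.

(** Self-adjointness turns each integrand into a coefficient of the orbit of [x], and linearity of
    the integral interchanges it with the finite sum. *)
Lemma sum_Rint_eq l tau x : self_adjoint H A ->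
  fold_right Rplus 0
    (map (fun g => Rint (fun t => Cabs2 (hinner H x (expop H A t g))) 0 tau) l)
  = orbit_energy l tau x.
Proof.
  intros Asa. unfold orbit_energy, energy. induction l as [| g l IH]; simpl.
  - rewrite RInt_const. symmetry; apply Rmult_0_r.
  - rewrite IH.
    assert (E : ex_RInt (fun t => Cabs2 <[expop H A t x, g]>) 0 tau)
      by apply continuity_ex_RInt, continuity_Cabs2_expop.
    symmetry. etransitivity;
      [exact (RInt_plus (V := R_CompleteNormedModule) _ _ 0 tau E (ex_RInt_energy l x 0 tau)) |].
    apply (f_equal2 Rplus); [| reflexivity].
    rewrite <- Rint_eq_RInt by exact E.
    apply (f_equal (fun f => Rint f 0 tau)). apply functional_extensionality; intros t.
    rewrite (expop_self_adjoint H A M Hcomp M_ge0 A_le t x g Asa). reflexivity.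
Qed.

Lemma orbit_energy_ge0 l tau x : 0 <= tau -> 0 <= orbit_energy l tau x.
Proof.
  intros Ht. apply RInt_ge_0; [exact Ht | apply ex_RInt_energy |].
  intros; apply energy_ge0.
Qed.

Lemma RInt_energy_le_orbit_energy l x a b tau : 0 <= a -> a <= b -> b <= tau ->
  RInt (fun t => energy H l (expop H A t x)) a b <= orbit_energy l tau x.
Proof.
  intros Ha Hb Ht. unfold orbit_energy.
  rewrite <- (RInt_Chasles (V := R_CompleteNormedModule) _ 0 a tau),
    <- (RInt_Chasles (V := R_CompleteNormedModule) _ a b tau) by apply ex_RInt_energy.
  change plus with Rplus.
  assert (P : forall c d, c <= d -> 0 <= RInt (fun t => energy H l (expop H A t x)) c d).
  { intros c d Hcd. apply RInt_ge_0; [exact Hcd | apply ex_RInt_energy |].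
    intros; apply energy_ge0. }
  pose proof (P 0 a Ha). pose proof (P b tau Ht).
  lra.
Qed.

Lemma orbit_energy_le_const l tau x c : 0 <= tau ->
  (forall t, 0 <= t <= tau -> energy H l (expop H A t x) <= c) ->
  orbit_energy l tau x <= tau * c.
Proof.
  intros Ht Hc. unfold orbit_energy.
  replace (tau * c) with (RInt (fun _ => c) 0 tau)
    by (rewrite RInt_const; unfold scal; simpl; unfold mult; simpl; ring).
  apply RInt_le; [exact Ht | apply ex_RInt_energy | apply ex_RInt_const |].
  intros t Hlt; apply Hc; lra.
Qed.

(* Averaging [|a|^2 <= 2 |b|^2 + 2 |a - b|^2] over [t] in [[s, s + h]]. *)
Lemma energy_expop_average l B s h tau x : 0 <= s -> 0 < h -> s + h <= tau ->
  0 <= B -> (forall y, energy H l y <= B * ‖y‖ ^ 2) ->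
  energy H l (expop H A s x)
    <= 2 / h * orbit_energy l tau x + 2 * B * (h * (M * exp (tau * M))) ^ 2 * ‖x‖ ^ 2.
Proof.
  intros Hs Hh Ht B0 HB. set (d := (h * (M * exp (tau * M))) ^ 2).
  set (e := energy H l (expop H A s x)).
  assert (I : h * ((e - 2 * B * d * ‖x‖ ^ 2) / 2) <= orbit_energy l tau x).
  { eapply Rle_trans; [| apply (RInt_energy_le_orbit_energy l x s (s + h)); lra].
    replace (h * _) with (RInt (fun _ => (e - 2 * B * d * ‖x‖ ^ 2) / 2) s (s + h))
      by (rewrite RInt_const; unfold scal; simpl; unfold mult; simpl; ring).
    apply RInt_le; [lra | apply ex_RInt_const | apply ex_RInt_energy |].
    intros t Hst.
    pose proof (energy_sub_le H l B (expop H A s x) (expop H A t x) HB) as P.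
    assert (D : ‖(expop H A s x [-] expop H A t x)‖ ^ 2 <= d * ‖x‖ ^ 2).
    { unfold d. rewrite <- Rpow_mult_distr. apply pow_incr. split; [apply hnorm_ge0 |].
      eapply Rle_trans; [apply (expop_lipschitz H A M Hcomp M_ge0 A_le tau);
                         rewrite Rabs_pos_eq; lra |].
      apply Rmult_le_compat_r; [apply hnorm_ge0 |].
      apply Rmult_le_compat_r.
      - apply Rmult_le_pos; [exact M_ge0 | left; apply exp_pos].
      - rewrite Rabs_left; lra. }
    apply (Rmult_le_compat_l B) in D; [| exact B0]. fold e in P. lra. }
  apply (Rmult_le_compat_l (2 / h)) in I; [| apply Rlt_le, Rdiv_lt_0_compat; lra].
  replace (2 / h * (h * ((e - 2 * B * d * ‖x‖ ^ 2) / 2)))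
    with (e - 2 * B * d * ‖x‖ ^ 2) in I by (field; lra). lra.
Qed.
End Orbit.

Lemma small_factor (c eps tau : R) : 0 <= c -> 0 < eps -> 0 < tau ->
  exists h, 0 < h /\ h <= 1 /\ h <= tau /\ c * h ^ 2 <= eps.
Proof.
  (* As [h <= 1], one has [c * h^2 <= (c + 1) * h <= eps]; the denominator [c + 1] is positive even
     for [c = 0]. *)
  intros Hc He Ht. set (h := Rmin (Rmin 1 tau) (eps / (c + 1))).
  assert (P : 0 < eps / (c + 1)) by (apply Rdiv_lt_0_compat; lra).
  assert (h0 : 0 < h) by (repeat apply Rmin_pos; lra).
  assert (h1 : h <= Rmin 1 tau) by apply Rmin_l.
  assert (h2 : h <= eps / (c + 1)) by apply Rmin_r.
  pose proof (Rmin_l 1 tau). pose proof (Rmin_r 1 tau).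
  exists h. repeat split; try lra.
  apply (Rmult_le_compat_l (c + 1)) in h2; [| lra].
  replace ((c + 1) * (eps / (c + 1))) with eps in h2 by (field; lra).
  nra.
Qed.

(** * The uniform Bessel bound *)

Section FrameBounds.
Variables (H : InnerProdSpace) (A : H -> H) (M : R).
Hypothesis Hcomp : hcomplete H.
Hypothesis M_ge0 : 0 <= M.
Hypothesis A_le : forall x, ‖(A x)‖ <= M * ‖x‖.

(* A priori the best Bessel constant of the finite family [l] depends on [l]; averaging
   over a short interval shows that it is at most half of itself plus a multiple of [c],
   and iterating removes the dependence on [l]. *)
Lemma energy_bessel l c : (forall x, orbit_energy H A l 1 x <= c * ‖x‖ ^ 2) ->
  forall x, energy H l x <= 8 * (M * exp M + 1) * c * ‖x‖ ^ 2.
Proof.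
  intros Hc.
  set (L := M * exp M + 1). set (B0 := fold_right Rplus 0 (map (fun g => ‖g‖ ^ 2) l)).
  assert (L1 : 1 <= L)
    by (unfold L; pose proof (Rmult_le_pos M (exp M) M_ge0 (Rlt_le _ _ (exp_pos M))); lra).
  assert (B0_ge0 : 0 <= B0).
  { unfold B0. clear. induction l as [| g l' IH]; cbn [map fold_right]; [lra |].
    pose proof (pow2_ge_0 ‖g‖). lra. }
  assert (c_ge0 : forall x : H, 0 <= c * ‖x‖ ^ 2).
  { intros x. eapply Rle_trans; [| apply Hc].
    apply (orbit_energy_ge0 H A M Hcomp M_ge0 A_le); lra. }
  (* With [h = 1 / (2 L)] averaging replaces a Bessel constant [B] by [4 L c + B / 2]. The fixed
     point of this map is [8 L c], and the excess [B0] over it is halved at each step. *)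
  assert (It : forall n (x : H), energy H l x <= 8 * L * c * ‖x‖ ^ 2 + B0 / 2 ^ n * ‖x‖ ^ 2).
  { destruct (classic (0 <= c)) as [c0 | c0].
    - induction n as [| n IH]; intros x.
      + pose proof (energy_le H l x) as E. fold B0 in E.
        pose proof (c_ge0 x). simpl pow at 2. unfold Rdiv. rewrite Rinv_1. nra.
      + assert (B_ge0 : 0 <= 8 * L * c + B0 / 2 ^ n).
        { apply Rplus_le_le_0_compat; [nra |].
          apply Rdiv_le_0_compat; [exact B0_ge0 | apply pow_lt; lra]. }
        pose proof (energy_expop_average H A M Hcomp M_ge0 A_le l (8 * L * c + B0 / 2 ^ n)
          0 (/ (2 * L)) 1 x (Rle_refl 0)) as E.
        rewrite expop_0 with (M := M) in E by assumption.
        assert (h0 : 0 < / (2 * L)) by (apply Rinv_0_lt_compat; lra).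
        assert (h1 : / (2 * L) <= 1) by (rewrite <- Rinv_1; apply Rinv_le_contravar; lra).
        specialize (E h0 ltac:(lra) B_ge0 ltac:(intros y; specialize (IH y); lra)).
        assert (D : (/ (2 * L) * (M * exp (1 * M))) ^ 2 <= 1 / 4).
        { replace (1 / 4) with ((/ (2 * L) * L) ^ 2) by (field; lra).
          apply pow_incr. rewrite Rmult_1_l. split.
          - apply Rmult_le_pos; [lra | unfold L in L1; lra].
          - apply Rmult_le_compat_l; [lra | unfold L; lra]. }
        replace (2 / / (2 * L)) with (4 * L) in E by (field; lra).
        replace (B0 / 2 ^ S n) with (B0 / 2 ^ n / 2)
          by (simpl; field; apply pow_nonzero; lra).
        set (B := 8 * L * c + B0 / 2 ^ n) in *.
        assert (D' : 2 * B * (/ (2 * L) * (M * exp (1 * M))) ^ 2 * ‖x‖ ^ 2 <= B / 2 * ‖x‖ ^ 2).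
        { apply Rmult_le_compat_r; [apply pow2_ge_0 |].
          apply (Rmult_le_compat_l (2 * B)) in D; lra. }
        pose proof (Rmult_le_compat_l (4 * L) _ _ ltac:(lra) (Hc x)).
        unfold B in D'. unfold B in E. lra.
    (* If [c < 0], then [0 <= c |x|^2] forces [|x| = 0], and both sides vanish. *)
    - intros n x. pose proof (c_ge0 x). pose proof (pow2_ge_0 ‖x‖).
      assert (Z : ‖x‖ ^ 2 = 0) by nra.
      pose proof (energy_le H l x) as E. rewrite Z in *. lra. }
  intros x. apply le_epsilon. intros eps He.
  destruct (cv_pow_half (B0 * ‖x‖ ^ 2) eps He) as [n Hn].
  specialize (Hn n (Nat.le_refl n)). unfold Rdist in Hn. apply Rabs_def2 in Hn.
  pose proof (It n x).
  replace (B0 / 2 ^ n * ‖x‖ ^ 2) with (B0 * ‖x‖ ^ 2 / 2 ^ n) in *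
    by (field; apply pow_nonzero; lra).
  lra.
Qed.

(** * Control of Taylor polynomials by the orbit energy on [[0, tau]] *)

Section Control.
Variables (L : list H -> Prop) (B tau : R).
Hypothesis B_ge0 : 0 <= B.
Hypothesis tau_gt0 : 0 < tau.
Hypothesis bessel : forall l, L l -> forall y, energy H l y <= B * ‖y‖ ^ 2.

(* In contradiction form: [T t x_n] has vanishing energy, uniformly in [t] satisfying [D],
   along bounded sequences [x_n] whose orbit energy on [[0, tau]] vanishes. *)
Definition controlled (D : R -> Prop) (T : R -> H -> H) : Prop :=
  forall eps, 0 < eps -> exists K, 0 <= K /\ forall t l x, D t -> L l ->
    energy H l (T t x) <= K * orbit_energy H A l tau x + eps * ‖x‖ ^ 2.

(** As [s < tau], there is room to average over [[s, s + h]]. A small [h] brings the error below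
    [eps] at the cost [K = 2 / h], which is the same for all [l] because they share the Bessel
    constant [B]. *)
Lemma controlled_expop s : 0 <= s < tau -> controlled (eq s) (expop H A).
Proof.
  intros Hs eps He. set (d := M * exp (tau * M)).
  destruct (small_factor (2 * B * d ^ 2) eps (tau - s)) as (h & h0 & _ & h2 & h3);
    [pose proof (pow2_ge_0 d); nra | lra | lra |].
  exists (2 / h). split; [apply Rlt_le, Rdiv_lt_0_compat; lra |].
  intros t l x <- Ll.
  eapply Rle_trans;
    [apply (energy_expop_average H A M Hcomp M_ge0 A_le l B s h tau x);
     auto; lra |].
  apply Rplus_le_compat_l, Rmult_le_compat_r; [apply pow2_ge_0 |].
  fold d. rewrite Rpow_mult_distr. lra.
Qed.

(* [s^(k+1)/(k+1)! A^(k+1) = e^(sA) - p_k(s) + O(s^(k+2))] with [p_k] the Taylor polynomial: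
   the first two terms are controlled, and dividing by [s^(k+1)] for small [s] leaves
   a small error. *)
Lemma controlled_iter k :
  controlled (fun s => 0 <= s <= 1) (expsum H A k) ->
  controlled (fun _ => True) (fun _ => Nat.iter (S k) A).
Proof.
  intros Ck eps He.
  pose proof (INR_fact_lt_0 (S k)) as F.
  (* [Q] is chosen so that the Taylor remainder beyond degree [k+1] is at most [w * s * Q * |x|],
     with [w] the coefficient of [A^(k+1)]: relative to [w] it is of order [s]. *)
  set (Q := M ^ S (S k) * exp M * INR (fact (S k))).
  destruct (small_factor (2 * B * Q ^ 2) (eps / 2) (tau / 2)) as (s & s0 & s1 & s2 & s3);
    [pose proof (pow2_ge_0 Q); nra | lra | lra |].
  set (w := s ^ S k / INR (fact (S k))).
  assert (w0 : 0 < w) by (apply Rdiv_lt_0_compat; [apply pow_lt, s0 | exact F]).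
  assert (w20 : 0 < w ^ 2) by (apply pow_lt, w0).
  (* The time [s] is now fixed, so tolerances may depend on [w]. The vectors [E] and [P] enter with
     factor 4 each and contribute [eps * w^2 / 2] in all; the Taylor remainder contributes the other
     half. *)
  destruct (controlled_expop s ltac:(lra) (eps * w ^ 2 / 16)) as (K1 & K10 & HK1); [nra |].
  destruct (Ck (eps * w ^ 2 / 16)) as (K2 & K20 & HK2); [nra |].
  exists ((4 * K1 + 4 * K2) / w ^ 2).
  split; [apply Rdiv_le_0_compat; lra |].
  intros _ l x _ Ll.
  specialize (HK1 s l x eq_refl Ll). specialize (HK2 s l x ltac:(lra) Ll).
  set (E := expop H A s x) in *. set (P := expsum H A k s x) in *.
  set (P' := expsum H A (S k) s x).
  assert (D : ‖(E [-] P')‖ <= w * (s * Q) * ‖x‖).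
  { eapply Rle_trans; [apply (expop_tail H A M Hcomp M_ge0 A_le s); rewrite Rabs_pos_eq; lra |].
    apply Rmult_le_compat_r; [apply hnorm_ge0 |].
    assert (sM : 0 <= s * M) by nra.
    eapply Rle_trans; [apply exp_partial_tail, sM |].
    replace (w * (s * Q)) with ((s * M) ^ S (S k) * exp M)
      by (unfold w, Q; rewrite Rpow_mult_distr; simpl pow; field; lra).
    apply Rmult_le_compat_l; [apply pow_le, sM |].
    destruct (Rle_lt_or_eq_dec (s * M) M) as [lt | ->]; [nra | | lra].
    left; apply exp_increasing, lt. }
  assert (D2 : B * ‖(E [-] P')‖ ^ 2 <= w ^ 2 * (eps / 4) * ‖x‖ ^ 2).
  { apply Rle_trans with (B * (w * (s * Q) * ‖x‖) ^ 2).
    - apply Rmult_le_compat_l; [exact B_ge0 |]. apply pow_incr. split; [apply hnorm_ge0 | exact D].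
    - replace (B * (w * (s * Q) * ‖x‖) ^ 2) with (w ^ 2 * (B * Q ^ 2 * s ^ 2) * ‖x‖ ^ 2) by ring.
      apply Rmult_le_compat_r; [apply pow2_ge_0 |].
      apply Rmult_le_compat_l; lra. }
  assert (S1 : w ^ 2 * energy H l (Nat.iter (S k) A x)
               <= 2 * energy H l (E [-] P) + 2 * energy H l (E [-] P')).
  { rewrite <- energy_scal.
    replace (w [*] Nat.iter (S k) A x) with ((E [-] P) [-] (E [-] P')).
    - apply energy_sub.
    - unfold P'. rewrite expsum_S. fold P w. vec. }
  pose proof (energy_sub H l E P). pose proof (bessel l Ll (E [-] P')).
  apply (Rmult_le_reg_l (w ^ 2)); [exact w20 |].
  replace (w ^ 2 * ((4 * K1 + 4 * K2) / w ^ 2 * orbit_energy H A l tau x + eps * ‖x‖ ^ 2))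
    with ((4 * K1 + 4 * K2) * orbit_energy H A l tau x + w ^ 2 * eps * ‖x‖ ^ 2)
    by (field; lra).
  lra.
Qed.

(** Induction alternating with [controlled_iter]: control of degree [k] gives control of [A^(k+1)],
    hence of degree [k+1]. It is uniform in [t] because [t^(k+1) / (k+1)! <= 1] on [[0, 1]]; degree
    0 is the exponential at time 0. *)
Lemma controlled_expsum k : controlled (fun s => 0 <= s <= 1) (expsum H A k).
Proof.
  induction k as [| k IH]; intros eps He.
  - destruct (controlled_expop 0 ltac:(lra) eps He) as (K & K0 & HK).
    exists K. split; [exact K0 |]. intros t l x _ Ll.
    specialize (HK 0 l x eq_refl Ll). rewrite expop_0 with (M := M) in HK by assumption.
    rewrite expsum_0. exact HK.
  - destruct (IH (eps / 4) ltac:(lra)) as (K1 & K10 & HK1).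
    destruct (controlled_iter k IH (eps / 4) ltac:(lra)) as (K2 & K20 & HK2).
    exists (2 * K1 + 2 * K2). split; [lra |]. intros t l x Ht Ll.
    specialize (HK1 t l x Ht Ll). specialize (HK2 t l x I Ll).
    rewrite expsum_S. eapply Rle_trans; [apply energy_add |]. rewrite energy_scal.
    pose proof (INR_fact_lt_0 (S k)) as F.
    assert (w0 : 0 <= t ^ S k / INR (fact (S k))) by (apply pow_div_fact_ge0; lra).
    assert (w1 : t ^ S k / INR (fact (S k)) <= 1).
    { apply Rle_div_l; [exact F |]. rewrite Rmult_1_l. apply Rle_trans with 1.
      - rewrite <- (pow1 (S k)). apply pow_incr. lra.
      - change 1 with (INR 1). apply le_INR. pose proof (lt_O_fact (S k)). lia. }
    pose proof (energy_ge0 H l (Nat.iter (S k) A x)).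
    set (w := t ^ S k / INR (fact (S k))) in *.
    assert (w ^ 2 * energy H l (Nat.iter (S k) A x) <= 1 * energy H l (Nat.iter (S k) A x))
      by (apply Rmult_le_compat_r; nra).
    lra.
Qed.

(** One Taylor polynomial approximates [e^(tA)] uniformly on [[0, 1]]. Its degree is fixed first,
    from [eps] and [B]; then its energy is controlled uniformly in [t], and the remainder is
    absorbed by the Bessel bound. *)
Lemma orbit_energy_1_le eps : 0 < eps -> exists K, 0 <= K /\ forall l x, L l ->
  orbit_energy H A l 1 x <= K * orbit_energy H A l tau x + eps * ‖x‖ ^ 2.
Proof.
  intros He.
  destruct (small_factor (2 * B) (eps / 2) 1) as (d & d0 & _ & _ & d2); [lra .. |].
  destruct (exp_partial_cv (1 * M) d d0) as [n Hn].
  specialize (Hn n (Nat.le_refl n)). unfold Rdist in Hn. apply Rabs_def2 in Hn.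
  destruct (controlled_expsum n (eps / 4) ltac:(lra)) as (K & K0 & HK).
  exists (2 * K). split; [lra |]. intros l x Ll.
  rewrite <- (Rmult_1_l (2 * K * _ + _)).
  apply (orbit_energy_le_const H A M Hcomp M_ge0 A_le); [lra |]. intros t Ht.
  specialize (HK t l x Ht Ll).
  pose proof (energy_sub_le H l B (expop H A t x) (expsum H A n t x) (bessel l Ll)) as P.
  assert (D : B * ‖(expop H A t x [-] expsum H A n t x)‖ ^ 2 <= eps / 4 * ‖x‖ ^ 2).
  { apply Rle_trans with (B * (d * ‖x‖) ^ 2).
    - apply Rmult_le_compat_l; [exact B_ge0 |]. apply pow_incr. split; [apply hnorm_ge0 |].
      eapply Rle_trans; [apply (expop_tail H A M Hcomp M_ge0 A_le 1); rewrite Rabs_pos_eq; lra |].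
      apply Rmult_le_compat_r; [apply hnorm_ge0 | lra].
    - rewrite Rpow_mult_distr, <- Rmult_assoc.
      apply Rmult_le_compat_r; [apply pow2_ge_0 | lra]. }
  lra.
Qed.

Lemma orbit_energy_upper l x : L l ->
  orbit_energy H A l tau x <= tau * (B * exp (tau * M) ^ 2) * ‖x‖ ^ 2.
Proof.
  intros Ll. rewrite Rmult_assoc.
  apply (orbit_energy_le_const H A M Hcomp M_ge0 A_le); [lra |]. intros t Ht.
  eapply Rle_trans; [apply bessel, Ll |]. rewrite Rmult_assoc, <- Rpow_mult_distr.
  apply Rmult_le_compat_l; [exact B_ge0 |]. apply pow_incr. split; [apply hnorm_ge0 |].
  apply (hnorm_expop_le H A M Hcomp M_ge0 A_le). rewrite Rabs_pos_eq; lra.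
Qed.

End Control.
End FrameBounds.

(** * Passage from finite families to the frame bounds *)

Theorem theorem3p11 (H : InnerProdSpace) (Hcomp : hcomplete H) (Hsep : hseparable H)
    (A : H -> H) (Abdd : bounded_linear H A) (Asa : self_adjoint H A)
    (G : H -> Prop) (Gcount : countable H G) :
  semi_cont_frame H A G 1 <-> (forall tau : R, 0 < tau -> semi_cont_frame H A G tau).
Proof.
  split; [| intros F; apply F; lra].
  intros (c1 & c2 & c1_gt0 & c2_gt0 & F1) tau tau_gt0.
  (* The given bound [M0] may be negative when all norms vanish, hence the maximum with 0. *)
  destruct Abdd as (_ & _ & M0 & HM0). set (M := Rmax M0 0).
  assert (M_ge0 : 0 <= M) by apply Rmax_r.
  assert (A_le : forall x, ‖(A x)‖ <= M * ‖x‖).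
  { intros x. eapply Rle_trans; [apply HM0 |].
    apply Rmult_le_compat_r; [apply hnorm_ge0 | apply Rmax_l]. }
  set (L := fun l : list H => NoDup l /\ forall g, In g l -> G g).
  assert (sums : forall s x r, frame_partial_sums H A G s x r <->
                   exists l, L l /\ r = orbit_energy H A l s x).
  { intros s x r. unfold frame_partial_sums, L. split; intros (l & E).
    - exists l. rewrite <- (sum_Rint_eq H A M Hcomp M_ge0 A_le) by exact Asa. tauto.
    - exists l. rewrite (sum_Rint_eq H A M Hcomp M_ge0 A_le) by exact Asa. tauto. }
  set (B := 8 * (M * exp M + 1) * c2).
  assert (B_gt0 : 0 < B).
  { pose proof (Rmult_le_pos M (exp M) M_ge0 (Rlt_le _ _ (exp_pos M))).
    apply Rmult_lt_0_compat; lra. }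
  assert (bessel : forall l, L l -> forall y, energy H l y <= B * ‖y‖ ^ 2).
  { intros l Ll. apply (energy_bessel H A M Hcomp M_ge0 A_le). intros x.
    destruct (F1 x) as (S & [ub _] & _ & up). eapply Rle_trans; [| exact up].
    apply ub, sums. exists l; auto. }
  destruct (orbit_energy_1_le H A M Hcomp M_ge0 A_le L B tau (Rlt_le _ _ B_gt0) tau_gt0 bessel
              (c1 / 2) ltac:(lra)) as (K & K_ge0 & HK).
  pose proof (orbit_energy_upper H A M Hcomp M_ge0 A_le L B tau (Rlt_le _ _ B_gt0) tau_gt0 bessel)
    as upper.
  set (c2' := tau * (B * exp (tau * M) ^ 2)) in *.
  assert (c2'_gt0 : 0 < c2').
  { apply Rmult_lt_0_compat, Rmult_lt_0_compat; auto. apply pow_lt, exp_pos. }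
  (* With [S1] and [S] the frame sums for times 1 and [tau],
     [c1 |x|^2 <= S1 <= K S + (c1 / 2) |x|^2] gives [(c1 / 2) |x|^2 <= K S <= (K + 1) S], since
     [S >= 0]; [K + 1] avoids division by zero. *)
  exists (c1 / (2 * (K + 1))), c2'.
  split; [apply Rdiv_lt_0_compat; lra | split; [exact c2'_gt0 |]].
  intros x.
  destruct (completeness (frame_partial_sums H A G tau x)) as [S HS].
  - exists (c2' * ‖x‖ ^ 2). intros r Hr. apply sums in Hr as (l & Ll & ->). apply upper, Ll.
  (* The empty family shows that the set of partial sums is nonempty, even for empty [G]. *)
  - exists (orbit_energy H A nil tau x). apply sums. exists nil. repeat split.
    + constructor.
    + intros g [].
  - exists S. split; [exact HS |]. destruct HS as [ub lub]. split.
    + destruct (F1 x) as (S1 & [_ lub1] & low & _).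
      assert (T : S1 <= K * S + c1 / 2 * ‖x‖ ^ 2).
      { apply lub1. intros r Hr. apply sums in Hr as (l & Ll & ->).
        eapply Rle_trans; [apply HK, Ll |].
        apply Rplus_le_compat_r, Rmult_le_compat_l; [exact K_ge0 |].
        apply ub, sums. exists l; auto. }
      assert (S_ge0 : 0 <= S).
      { apply Rle_trans with (orbit_energy H A nil tau x).
        - apply (orbit_energy_ge0 H A M Hcomp M_ge0 A_le); lra.
        - apply ub, sums. exists nil. repeat split; [constructor | intros g []]. }
      replace (c1 / (2 * (K + 1)) * ‖x‖ ^ 2) with (c1 * ‖x‖ ^ 2 / 2 / (K + 1)) by (field; lra).
      apply Rle_div_l; lra.
    + apply lub. intros r Hr. apply sums in Hr as (l & Ll & ->). apply upper, Ll.
Qed.
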